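(* Let $k$ be a field, let $c \geq 7$, let $S = k[x_0, \ldots, x_{c-1}]$ be a standard graded polynomial ring, and let $D = k[y_0, \dots, y_{c-1}]$ be regarded as an $S$-module via the contraction action. Consider the inverse polynomial $$F = \sum_{i \in \mathbb{Z}/c\mathbb{Z}} y_i\, y_{i+1}\, y_{i+2}^2 \in D,$$ where indices are taken modulo $c$, and let $I_F = (0 :_S F) = \{ f \in S \mid f \cdot F = 0\}$ be the corresponding ideal of $S$. Then $R = S/I_F$ is a quadratic Gorenstein ring which is not Koszul, with $h$-vector $h(R) = (1, c, 2c, c, 1)$.
   Context: The contraction action of $S = k[x_0,\dots,x_{c-1}]$ on $D = k[y_0,\dots,y_{c-1}]$ is defined on monomials, for $\alpha, \beta \in \mathbb{N}^c$, by $x^\alpha \cdot y^\beta = y^{\beta - \alpha}$ if $\beta_i \geq \alpha_i$ for all $i$, and $x^\alpha \cdot y^\beta = 0$ otherwise, and is extended $k$-bilinearly. The field $k$ has arbitrary characteristic. The ring $R = S/I$ is quadratic if $I$ is generated by quadrics (homogeneous forms of degree 2). It is Koszul if the residue field $k = R/R_+$ has a linear free resolution over $R$, i.e. $\operatorname{Tor}^R_i(k,k)_j = 0$ for all $i$ and all $j \neq i$. For a Cohen-Macaulay ring $R$ the $h$-vector $h(R) = (1, h_1, \dots, h_r)$ is defined by writing the Hilbert series as $H_R(t) = (1 + h_1 t + \cdots + h_r t^r)/(1-t)^{\dim R}$; here $R$ is Artinian, so $h_i = \dim_k R_i$. *)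

(* Defs.v *)
From HB Require Import structures.
From mathcomp Require Import all_boot all_order all_algebra.
From mathcomp Require Import ring_quotient ssrcomplements mpoly.

Set Implicit Arguments.
Unset Strict Implicit.
Unset Printing Implicit Defensive.

Import GRing.Theory.
Local Open Scope ring_scope.
Local Open Scope quotient_scope.

Section CommutativeAlgebra.
Variable A : comNzRingType.
Implicit Types (J Q : A -> Prop).

Definition is_ideal J : Prop :=
  [/\ J 0, forall x y, J x -> J y -> J (x + y) & forall a x, J x -> J (a * x)].

Definition ideal_gen Q (x : A) : Prop :=
  exists s : seq (A * A),
    (forall t, t \in s -> Q t.2) /\ x = \sum_(t <- s) t.1 * t.2.

Definition is_prime J : Prop :=
  [/\ is_ideal J, ~ J 1 & forall x y, J (x * y) -> J x \/ J y].

Definition prime_chain (d : nat) : Prop :=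
  exists p : nat -> A -> Prop,
    (forall i, (i <= d)%N -> is_prime (p i)) /\
    (forall i, (i < d)%N ->
       (forall x, p i x -> p i.+1 x) /\ (exists x, p i.+1 x /\ ~ p i x)).

Definition krull_dim (d : nat) : Prop := prime_chain d /\ ~ prime_chain d.+1.

Definition noetherian : Prop :=
  forall J, is_ideal J ->
  exists s : seq A, forall x, J x <-> ideal_gen (fun y => y \in s) x.

Definition injective_module (E : lmodType A) : Prop :=
  forall (M N : lmodType A) (f : {linear M -> N}) (g : {linear M -> E}),
    injective f -> exists h : {linear N -> E}, forall x, h (f x) = g x.

(* An injective coresolution 0 -> M -> E_0 -> ... -> E_n -> 0, cut into short
   exact sequences 0 -> M -> E_0 -> C -> 0 with inj.dim C <= n - 1. *)
Fixpoint injdim_le (n : nat) (M : lmodType A) : Prop :=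
  if n is n'.+1 then
    exists (E C : lmodType A) (f : {linear M -> E}) (g : {linear E -> C}),
      [/\ injective_module E, injective f,
          forall y, g y = 0 <-> exists x, y = f x,
          forall z, exists y, g y = z & injdim_le n' C]
  else injective_module M.

(* Noetherian of finite injective dimension over itself.  When the Krull
   dimension is finite this is the same as asking it of every localization. *)
Definition gorenstein : Prop :=
  noetherian /\ exists n, injdim_le n (A^o : lmodType A).

End CommutativeAlgebra.

(* [gr i] is the set of homogeneous elements of degree i, 0 included. *)

Section GradedAlgebra.
Variables (k : fieldType) (A : comAlgType k) (gr : nat -> A -> Prop).

Definition has_dim (W : A -> Prop) (n : nat) : Prop :=
  exists b : 'I_n -> A,
    (forall w, W w <-> exists a : 'I_n -> k, w = \sum_i a i *: b i) /\
    (forall a : 'I_n -> k, \sum_i a i *: b i = 0 -> forall i, a i = 0).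

(* H_A(t) * (1 - t)^(dim A) = h_0 + h_1 t + ... + h_r t^r with h_r <> 0,
   compared coefficient by coefficient. *)
Definition h_vector (h : seq int) : Prop :=
  exists (d : nat) (H : nat -> nat),
    [/\ krull_dim A d, forall i, has_dim (gr i) (H i), last 0 h != 0
      & forall n, \sum_(j < n.+1) ((1 - 'X : {poly int}) ^+ d)`_j * (H (n - j)%N)%:Z
                  = h`_n].

Definition irrelevant_ideal : A -> Prop :=
  ideal_gen (fun x => exists2 i, (0 < i)%N & gr i x).

(* The residue field k = A / A_+ has a linear free resolution
     ... -> A(-2)^(b 2) -> A(-1)^(b 1) -> A -> k -> 0.
   Elements of A^(b i) are row vectors and [d i] : A^(b i.+1) -> A^(b i) acts
   on the right; a degree 0 map A(-i-1)^m -> A(-i)^n is a matrix of elements of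
   degree 1.  Since A_1 generates A_+ with finitely many elements for a standard
   graded A, and such a resolution is minimal, all ranks are finite. *)
Definition koszul : Prop :=
  exists (b : nat -> nat) (d : forall i, 'M[A]_(b i.+1, b i)),
    [/\ b 0%N = 1%N,
        forall i r s, gr 1%N (d i r s),
        forall v : 'rV[A]_(b 0%N),
          (exists u, v = u *m d 0%N) <-> (forall j, irrelevant_ideal (v 0 j))
      & forall i (v : 'rV[A]_(b i.+1)),
          (exists u, v = u *m d i.+1) <-> v *m d i = 0].

End GradedAlgebra.

(* The library only provides the ring structure of a quotient. *)

Section QuotientAlgebra.
Variables (k : fieldType) (A : comAlgType k) (I : idealr A).
Local Notation Q := (Quotient.quot I).

Definition quot_scale (a : k) (x : Q) : Q := \pi_Q (a%:A) * x.

Fact quot_scaleA a b x : quot_scale a (quot_scale b x) = quot_scale (a * b) x.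
Proof. by rewrite /quot_scale mulrA -rmorphM /= -scalerAl mul1r scalerA. Qed.

Fact quot_scale1 : left_id 1 quot_scale.
Proof. by move=> x; rewrite /quot_scale scale1r rmorph1 mul1r. Qed.

Fact quot_scaleDr : right_distributive quot_scale +%R.
Proof. by move=> a x y; rewrite /quot_scale mulrDr. Qed.

Fact quot_scaleDl x : {morph quot_scale^~ x : a b / a + b}.
Proof. by move=> a b; rewrite /quot_scale scalerDl rmorphD mulrDl. Qed.

HB.instance Definition _ := GRing.Zmodule_isLmodule.Build k Q
  quot_scaleA quot_scale1 quot_scaleDr quot_scaleDl.

Fact quot_scaleAl (a : k) (x y : Q) : a *: (x * y) = (a *: x) * y.
Proof. exact: mulrA. Qed.

HB.instance Definition _ := GRing.Lmodule_isLalgebra.Build k Q quot_scaleAl.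
HB.instance Definition _ := GRing.Lalgebra_isComAlgebra.Build k Q.

End QuotientAlgebra.

Section InverseSystem.
Variables (k : fieldType) (n : nat).
Local Notation S := {mpoly k[n]}.
Implicit Types (f g h F : S) (m : 'X_{1..n}).

Definition quot_gr (I : idealr S) (d : nat) (x : {ideal_quot I}) : Prop :=
  exists f, f \is d.-homog /\ x = \pi_({ideal_quot I}) f.

Definition quadratic_ideal (I : S -> Prop) : Prop :=
  exists Q : S -> Prop,
    (forall q, Q q -> q \is 2.-homog) /\ (forall f, I f <-> ideal_gen Q f).

Definition contract_mon (a b : 'X_{1..n}) : S :=
  if (a <= b)%MM then 'X_[(b - a)%MM] else 0.

(* Both S and D are represented by the type {mpoly k[n]}. *)
Definition contract f g : S :=
  \sum_(a <- msupp f) \sum_(b <- msupp g) (f@_a * g@_b) *: contract_mon a b.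

Lemma contractE f g m : (contract f g)@_m = \sum_(a <- msupp f) f@_a * g@_(a + m).
Proof.
rewrite /contract raddf_sum; apply: eq_bigr => a _ /=.
rewrite [in RHS](mpolyE g) !raddf_sum mulr_sumr; apply: eq_bigr => b _ /=.
rewrite !mcoeffZ -mulrA; congr (_ * (_ * _)).
rewrite /contract_mon mcoeffX; case: ifP => [le_ab|nle_ab]; last first.
  rewrite mcoeff0; case: eqP => // eq_b.
  by move: nle_ab; rewrite eq_b lem_addr.
rewrite mcoeffX; congr (_%:R); congr nat_of_bool; apply/eqP/eqP => [<-|->].
  by rewrite addmC submK.
by rewrite [(a + m)%MM]addmC addmK.
Qed.

Lemma contractEw d f g m : (msize f <= d)%N ->
  (contract f g)@_m = \sum_(a : 'X_{1..n < d}) f@_a * g@_(a + m).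
Proof.
move=> le_fd; rewrite contractE; set I : subFinType _ := 'X_{1..n < d}.
rewrite (big_mksub I) ?msupp_uniq //=; first last.
  by move=> a /msize_mdeg_lt /leq_trans; apply.
rewrite big_rmcond //= => a /memN_msupp_eq0 ->.
by rewrite mul0r.
Qed.

Lemma contract0l g : contract 0 g = 0.
Proof. by rewrite /contract msupp0 big_nil. Qed.

Lemma contractDl f h g : contract (f + h) g = contract f g + contract h g.
Proof.
apply/mpolyP => m; rewrite mcoeffD.
pose d := maxn (msize (f + h)) (maxn (msize f) (msize h)).
have [le1 le2 le3] : [/\ (msize (f + h) <= d)%N, (msize f <= d)%N
                       & (msize h <= d)%N] by rewrite /d !leq_max !leqnn !orbT.
rewrite !(@contractEw d) // -big_split /=; apply: eq_bigr => a _.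
by rewrite mcoeffD mulrDl.
Qed.

Lemma contractZl c f g : contract (c *: f) g = c *: contract f g.
Proof.
apply/mpolyP => m; rewrite mcoeffZ.
pose d := maxn (msize (c *: f)) (msize f).
have [le1 le2] : (msize (c *: f) <= d)%N /\ (msize f <= d)%N.
  by rewrite /d !leq_max !leqnn orbT.
rewrite !(@contractEw d) // mulr_sumr; apply: eq_bigr => a _.
by rewrite mcoeffZ mulrA.
Qed.

Lemma contractNl f g : contract (- f) g = - contract f g.
Proof. by rewrite -scaleN1r contractZl scaleN1r. Qed.

Lemma contractXl m g p : (contract 'X_[m] g)@_p = g@_(m + p).
Proof. by rewrite contractE msuppX big_seq1 mcoeffX eqxx mul1r. Qed.

Lemma contract1l g : contract 1 g = g.
Proof. by apply/mpolyP => p; rewrite -mpolyX0 contractXl add0m. Qed.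

Lemma contractXXl m p g : contract 'X_[m + p] g = contract 'X_[m] (contract 'X_[p] g).
Proof. by apply/mpolyP => q; rewrite !contractXl addmA [(p + m)%MM]addmC. Qed.

Lemma contractXM m f g : contract ('X_[m] * f) g = contract 'X_[m] (contract f g).
Proof.
elim/mpolyind: f => [|c p f _ _ IHf].
  by rewrite mulr0 contract0l; apply/mpolyP => q; rewrite contractXl !mcoeff0.
rewrite mulrDr -scalerAr -mpolyXD.
rewrite !(contractDl (c *: _)) IHf !contractZl contractXXl.
apply/mpolyP => q; rewrite mcoeffD mcoeffZ !contractXl.
by rewrite mcoeffD mcoeffZ contractXl.
Qed.

Lemma contractr0 f : contract f 0 = 0.
Proof. by rewrite /contract msupp0; apply: big1 => a _; rewrite big_nil. Qed.

(* The annihilator (0 :_S F).  The proof of F != 0 is a parameter because the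
   library's ideal quotients are only defined for proper ideals. *)
Definition annihilator F (F_neq0 : F != 0) : {pred S} :=
  fun f => contract f F == 0.

Fact annihilator_idealr F (F_neq0 : F != 0) : idealr_closed (annihilator F_neq0).
Proof.
split; rewrite ?unfold_in ?contract0l ?contract1l // => h f g.
rewrite !unfold_in => /eqP f0 /eqP g0.
rewrite contractDl g0 addr0; elim/mpolyind: h => [|c p h _ _ IHh].
  by rewrite mul0r contract0l.
rewrite mulrDl contractDl (eqP IHh) addr0 -scalerAl contractZl contractXM f0.
by rewrite contractr0 scaler0.
Qed.

HB.instance Definition _ F (F_neq0 : F != 0) :=
  isIdealr.Build S (annihilator F_neq0) (annihilator_idealr F_neq0).

End InverseSystem.

(* [ordS i] is i + 1 modulo c. *)
Definition cyclicF (k : fieldType) (c : nat) : {mpoly k[c]} :=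
  \sum_(i < c) 'X_i * 'X_(ordS i) * 'X_(ordS (ordS i)) ^+ 2.

Fact cyclicF_neq0 (k : fieldType) (c : nat) : (7 <= c)%N -> cyclicF k c != 0.
Proof.
move=> c_ge7; have c_gt0 : (0 < c)%N by apply: leq_trans c_ge7.
pose i0 : 'I_c := Ordinal c_gt0.
pose mon (i : 'I_c) := (U_(i) + U_(ordS i) + U_(ordS (ordS i)) *+ 2)%MM.
have FE : cyclicF k c = \sum_i 'X_[mon i].
  by apply: eq_bigr => i _; rewrite mpolyXn -!mpolyXD.
have ordSinj : injective (@ordS c) by apply: can_inj (@ordSK c).
apply/eqP => F0; have /eqP := congr1 (mcoeff (mon i0)) F0.
rewrite FE raddf_sum mcoeff0 (bigD1 i0) //= big1 ?addr0.
  by rewrite mcoeffX eqxx oner_eq0.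
move=> i ne_i; rewrite mcoeffX; case: eqP => // eq_mon.
have val1 : ordS i0 = 1%N :> nat by rewrite /= modn_small // (leq_trans _ c_ge7).
have val2 : ordS (ordS i0) = 2%N :> nat.
  by rewrite /= !modn_small // ?(leq_trans _ c_ge7).
have := congr1 (fun m : 'X_{1..c} => m (ordS (ordS i0))) eq_mon.
rewrite /mon !mnmDE !mnm1E eqxx.
have neqE (x y : 'I_c) : x <> y :> nat -> (x == y) = false.
  by move=> ne_xy; apply/eqP => eq_xy; rewrite eq_xy in ne_xy.
rewrite (neqE i0) ?val2 // (neqE (ordS i0)) ?val1 ?val2 //.
rewrite !(inj_eq ordSinj) (negbTE ne_i) !addn0.
case: (i =P ordS (ordS i0)) => [->|_]; last by case: (_ == _).
by rewrite (neqE (ordS (ordS i0))) ?val1 ?val2.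
Qed.

(* Main.v *)
Require Import Defs.
From HB Require Import structures.
From mathcomp Require Import all_boot all_order all_algebra.
From mathcomp Require Import ring_quotient mpoly.
From mathcomp Require Import ring.
From mathcomp Require boolp classical_sets.

(* Let J be the ideal generated by the x_i x_j with i, j at cyclic distance at
   least 3 and the x_(i+3)^2 - x_i x_(i+2).  These quadrics kill F, and modulo J
   every polynomial reduces to a combination of the 4c + 2 monomials
     1, X_i = x_i, U_i = x_i x_(i+1), V_i = x_i x_(i+2),
     T_i = x_i x_(i+1) x_(i+2), E = x_i x_(i+1) x_(i+2)^2 (for every i).
   Under the form (f, g) |-> ((f g) . F)(0) these monomials are dual to one
   another: 1 to E, X_i to T_(i-2), U_i to V_(i-1).  Hence they are a basis of
   both S/J and S/I_F, so I_F = J, and R is a Frobenius algebra: it is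
   self-injective because functionals on R-modules are represented by the form.

   If k had a linear resolution over R, the relation
     sum_i x_i x_(i+2) (x_(i+1) e_(i+2) - x_(i+2) e_(i+1)) = 0,
   i.e. sum_i T_i e_(i+2) - T_(i-1) e_(i+1) = 0, would be a combination of
     linear
   second syzygies.  A functional involving only the
   indices 0, ..., 4 vanishes on all such combinations, and takes the value 1 on
   that relation. *)

Set Implicit Arguments.
Unset Strict Implicit.
Unset Printing Implicit Defensive.

Import GRing.Theory.
Local Open Scope ring_scope.
Local Open Scope quotient_scope.

(** * The cyclic index *)

Section CyclicIndex.
Variable n : nat.
Local Notation Z := 'I_n.+4.+3.

(** Here [c >= 7] enters: an index difference between 1 and 6 in absolute value stays nonzero modulo
    c. *)
Lemma natr_neq0 m : (0 < m < 7)%N -> m%:R != 0 :> Z.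
Proof.
move=> /andP[m_gt0 m_lt7]; apply/eqP => /(congr1 val).
rewrite Zp_nat /= modn_small; last exact: leq_trans m_lt7 _.
by move=> m0; rewrite m0 in m_gt0.
Qed.

Lemma ordS_add1 (i : Z) : ordS i = i + 1.
Proof. by apply/val_inj; rewrite /= modnDmr addn1. Qed.

End CyclicIndex.

Ltac ord_neq_by t m :=
  rewrite (_ : t = m%:R); [exact: natr_neq0 | ring].

Ltac ord_neq :=
  rewrite -subr_eq0;
  match goal with |- is_true (?t != 0) =>
    first [ ord_neq_by t 1%N | ord_neq_by t 2%N | ord_neq_by t 3%N
          | ord_neq_by t 4%N | ord_neq_by t 5%N | ord_neq_by t 6%N
          | rewrite -oppr_eq0;
            match goal with |- is_true (?u != 0) =>
              first [ ord_neq_by u 1%N | ord_neq_by u 2%N | ord_neq_by u 3%N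
                    | ord_neq_by u 4%N | ord_neq_by u 5%N | ord_neq_by u 6%N ]
            end ]
  end.

(** True equalities of cyclic indices are proved by [ring]; a false one is recognized because its
    two sides differ by a constant m or -m with m from 1 to 6. *)
Ltac ord_decide :=
  repeat match goal with |- context [@eq_op ?T ?a ?b] =>
    first [ rewrite (_ : @eq_op T a b = true); last by apply/eqP; ring
          | rewrite (_ : @eq_op T a b = false); last by apply/negbTE; ord_neq ]
  end; rewrite ?mulr1n ?mulr0n ?addr0 ?add0r.

Definition far n (i j : 'I_n.+4.+3) : bool :=
  [&& j != i, j != i + 1, j != i + 2, j != i - 1 & j != i - 2].

(** * Multiplication table of the standard monomials *)

Section MultiplicationTable.
Variables (n : nat) (A : comNzRingType) (X : 'I_n.+4.+3 -> A).
Local Notation Z := 'I_n.+4.+3.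
Hypothesis mulX_far : forall i j, far i j -> X i * X j = 0.
Hypothesis mulX_sq : forall i, X (i + 3) * X (i + 3) = X i * X (i + 2).
Implicit Types i j : Z.

Definition Umon i := X i * X (i + 1).
Definition Vmon i := X i * X (i + 2).
Definition Tmon i := X i * X (i + 1) * X (i + 2).
Definition Emon := Tmon 0 * X 2.

Let sqE i : X i * X i = X (i - 3) * X (i - 1).
Proof.
have := mulX_sq (i - 3); rewrite (_ : i - 3 + 3 = i); last by ring.
by rewrite (_ : i - 3 + 2 = i - 1) //; ring.
Qed.

Let far3 i j : j = i + 3 -> X i * X j = 0.
Proof. by move=> ->; apply: mulX_far; do 4?[apply/andP; split]; ord_neq. Qed.

Let far4 i j : j = i + 4 -> X i * X j = 0.
Proof. by move=> ->; apply: mulX_far; do 4?[apply/andP; split]; ord_neq. Qed.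

(** The square relation turns X_(j+1) X_(j+2) X_(j+3)^2 into X_j X_(j+1) X_(j+2)^2, so the index 0
    in [Emon] is an arbitrary choice. *)
Lemma Tmon_mul i : Tmon i * X (i + 2) = Emon.
Proof.
have step j : Tmon (j + 1) * X (j + 1 + 2) = Tmon j * X (j + 2).
  rewrite /Tmon (_ : j + 1 + 1 = j + 2); last by ring.
  rewrite (_ : j + 1 + 2 = j + 3); last by ring.
  by rewrite -[LHS]mulrA mulX_sq; ring.
rewrite -(natr_Zp i); elim: {i}(val i) => [|m IHm]; first by rewrite add0r.
by rewrite -natr1 step.
Qed.

Lemma near_or_far i j :
  far i j \/ [\/ j = i, j = i + 1, j = i + 2 | j = i - 1 \/ j = i - 2].
Proof.
have [|] := boolP (far i j); first by left.
rewrite !negb_and !negbK => near; right.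
case/or4P: near => [/eqP->|/eqP->|/eqP->|/orP near].
- exact: Or41.
- exact: Or42.
- exact: Or43.
- by apply: Or44; case: near => /eqP; [left | right].
Qed.

(** The index conditions exclude one another, so at most one term survives. Boolean multiplicities
    put all cases in one formula, which linear maps traverse by [linearMn]. *)
Lemma mulXX j i : X j * X i =
  Vmon (i - 3) *+ (j == i) + Umon i *+ (j == i + 1) + Umon j *+ (j == i - 1)
  + Vmon i *+ (j == i + 2) + Vmon j *+ (j == i - 2).
Proof.
have [far_ij|] := near_or_far i j.
  have /and5P[/negbTE-> /negbTE-> /negbTE-> /negbTE-> /negbTE->] := far_ij.
  by rewrite mulrC mulX_far // !addr0.
case=> [->|->|->|[]->]; ord_decide.
- by rewrite sqE /Vmon (_ : i - 3 + 2 = i - 1) //; ring.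
- exact: mulrC.
- exact: mulrC.
- by rewrite /Umon (_ : i - 1 + 1 = i) //; ring.
- by rewrite /Vmon (_ : i - 2 + 2 = i) //; ring.
Qed.

Lemma mulXU j i : X j * Umon i =
  Tmon (i - 1) *+ (j == i - 1) + Tmon i *+ (j == i + 2)
  + Tmon (i - 3) *+ (j == i + 1).
Proof.
have [far_ij|] := near_or_far i j.
  have /and5P[_ /negbTE-> /negbTE-> /negbTE-> _] := far_ij.
  by rewrite mulrA (mulrC (X j)) mulX_far // mul0r !addr0.
case=> [->|->|->|[]->]; ord_decide.
- by rewrite /Umon mulrA sqE mulrAC far4 ?mul0r //; ring.
(* The square relation is used twice: X_i X_(i+1)^2 = X_(i-2) X_i^2 = X_(i-3) X_(i-2) X_(i-1). *)
- rewrite [RHS]/Tmon /Umon (_ : i - 3 + 1 = i - 2); last by ring.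
  rewrite (_ : i - 3 + 2 = i - 1); last by ring.
  rewrite [X i * _]mulrC mulrA sqE (_ : i + 1 - 3 = i - 2); last by ring.
  rewrite (_ : i + 1 - 1 = i); last by ring.
  by rewrite -mulrA sqE; ring.
- by rewrite /Tmon /Umon mulrC.
- rewrite /Tmon /Umon (_ : i - 1 + 1 = i); last by ring.
  by rewrite (_ : i - 1 + 2 = i + 1) ?mulrA //; ring.
- rewrite /Umon [X i * _]mulrC mulrA far3 ?mul0r //; ring.
Qed.

Lemma mulXV j i : X j * Vmon i =
  Tmon i *+ (j == i + 1) + Tmon (i - 1) *+ (j == i + 2).
Proof.
have [far_ij|] := near_or_far i j.
  have /and5P[_ /negbTE-> /negbTE-> _ _] := far_ij.
  by rewrite mulrA (mulrC (X j)) mulX_far // mul0r !addr0.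
case=> [->|->|->|[]->]; ord_decide.
- rewrite /Vmon mulrA sqE -mulrA far3 ?mulr0 //; ring.
- by rewrite /Tmon /Vmon; ring.
- rewrite /Vmon /Tmon [X i * _]mulrC mulrA sqE (_ : i + 2 - 1 = i + 1);
    last by ring.
  rewrite (_ : i - 1 + 1 = i); last by ring.
  rewrite (_ : i - 1 + 2 = i + 1); last by ring.
  by rewrite (_ : i + 2 - 3 = i - 1) 1?mulrAC //; ring.
- rewrite /Vmon [X i * _]mulrC mulrA far3 ?mul0r //; ring.
- rewrite /Vmon [X i * _]mulrC mulrA far4 ?mul0r //; ring.
Qed.

(** Write T_i = X_(i+2) U_i and expand X_j U_i first. Both T_(i-1) and T_(i-3) contain X_(i-1) or
    are killed through it by X_(i+2), at distance 3, so only the T_i term remains. *)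
Lemma mulXT j i : X j * Tmon i = Emon *+ (j == i + 2).
Proof.
have z1 : X (i + 2) * Tmon (i - 1) = 0.
  rewrite (_ : _ * _ = X (i - 1) * X (i + 2) * (X (i - 1 + 1) * X (i - 1 + 2))).
    by rewrite far3 ?mul0r //; ring.
  by rewrite /Tmon; ring.
have z2 : X (i + 2) * Tmon (i - 3) = 0.
  rewrite (_ : _ * _ = X (i - 3 + 2) * X (i + 2) * (X (i - 3) * X (i - 3 + 1))).
    by rewrite far3 ?mul0r //; ring.
  by rewrite /Tmon; ring.
rewrite (_ : Tmon i = X (i + 2) * Umon i); last by rewrite /Tmon mulrC.
rewrite mulrCA mulXU !mulrDr !mulrnAr z1 z2 !mul0rn add0r addr0.
by rewrite mulrC Tmon_mul.
Qed.

Lemma mulXE j : X j * Emon = 0.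
Proof.
(* E is rewritten as T_(j+3) X_(j+5), and X_j kills T_(j+3) because j differs from j + 5. *)
rewrite -(Tmon_mul (j + 3)) mulrA mulXT.
by ord_decide; rewrite mul0r.
Qed.

Lemma mulUU i j : Umon i * Umon j = 0.
Proof.
rewrite -mulrA mulXU !mulrDr !mulrnAr !mulXT.
have [->|_] := eqVneq i (j - 1 + 2); ord_decide;
  first by rewrite ?mul0rn ?addr0.
have [->|_] := eqVneq i (j + 2); ord_decide; first by rewrite ?mul0rn ?addr0.
have [->|_] := eqVneq i (j - 3 + 2); ord_decide; rewrite ?mul0rn ?addr0 //.
Qed.

Lemma mulVV i j : Vmon i * Vmon j = 0.
Proof.
rewrite -mulrA mulXV !mulrDr !mulrnAr !mulXT.
have [->|_] := eqVneq i (j + 2); ord_decide; first by rewrite ?mul0rn ?addr0.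
have [->|_] := eqVneq i (j - 1 + 2); ord_decide; rewrite ?mul0rn ?addr0 //.
Qed.

(** With [mulUU] and [mulVV], this makes the degree 2 part of the form pair each U_j with V_(j-1)
    and with nothing else. *)
Lemma mulVU i j : Vmon i * Umon j = Emon *+ (j == i + 1).
Proof.
rewrite -mulrA mulXU !mulrDr !mulrnAr !mulXT.
have [->|ne] := eqVneq j (i + 1); ord_decide;
  first by rewrite ?mul0rn ?addr0 ?add0r.
have [->|_] := eqVneq i (j - 1 + 2); ord_decide;
  first by rewrite ?mul0rn ?addr0.
have [->|_] := eqVneq i (j + 2); ord_decide; first by rewrite ?mul0rn ?addr0.
have [ei|_] := eqVneq i (j - 3 + 2); last by rewrite ?mul0rn ?addr0.
by case/eqP: ne; rewrite ei; ring.
Qed.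

End MultiplicationTable.

(** * The inverse system of F *)

Section Socle.
Variables (k : fieldType) (n : nat).
Local Notation c := n.+4.+3.
Local Notation Z := 'I_c.
Local Notation S := {mpoly k[c]}.
Local Notation F := (cyclicF k c).

Definition soc (f : S) : k := (contract f F)@_0.

Fact soc_is_scalar : scalar soc.
Proof. by move=> a f g; rewrite /soc contractDl contractZl mcoeffD mcoeffZ. Qed.

HB.instance Definition _ := GRing.isLinear.Build k S k *%R soc soc_is_scalar.

Lemma soc_mon m : soc 'X_[m] = F@_m.
Proof. by rewrite /soc contractXl addm0. Qed.

Lemma soc_monM m f : soc ('X_[m] * f) = (contract f F)@_m.
Proof. by rewrite /soc contractXM contractXl addm0. Qed.

(** The coefficient of f . F at m is [soc ('X_[m] * f)], so the annihilator is the radical of the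
    form. *)
Lemma mem_annihilatorP (F_neq0 : F != 0) f :
  f \in annihilator F_neq0 <-> forall h, soc (h * f) = 0.
Proof.
split=> [f_ann h | soc0].
  have /eqP hf0 : contract (h * f) F == 0.
    by have := idealMr h f_ann; rewrite unfold_in.
  by rewrite /soc hf0 mcoeff0.
by rewrite unfold_in; apply/eqP/mpolyP => m; rewrite -soc_monM soc0 mcoeff0.
Qed.

Lemma soc_mul_eq0 q :
  (forall m, soc ('X_[m] * q) = 0) -> forall h, soc (h * q) = 0.
Proof.
move=> q0 h; rewrite (mpolyE h) mulr_suml linear_sum big1 // => m _.
by rewrite -scalerAl linearZ /= q0 mulr0.
Qed.

Definition fterm (l : Z) : 'X_{1..c} :=
  (U_(l) + U_((l + 1)%R) + U_((l + 2)%R) *+ 2)%MM.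

Lemma cyclicFE : F = \sum_l 'X_[fterm l].
Proof.
apply: eq_bigr => l _; rewrite !ordS_add1 mpolyXn -!mpolyXD /fterm.
by rewrite (_ : l + 1 + 1 = l + 2) //; ring.
Qed.

Lemma ftermE l i :
  fterm l i = ((l == i) + ((l + 1)%R == i) + ((l + 2)%R == i) * 2)%N.
Proof. by rewrite /fterm mnmDE mnmDE mulmnE !mnm1E. Qed.

Lemma mdeg_fterm l : mdeg (fterm l) = 4%N.
Proof. by rewrite /fterm mdegD mdegD mdegMn !mdeg1. Qed.

Lemma mcoeff_cyclicF m : F@_m = \sum_l (fterm l == m)%:R.
Proof.
by rewrite cyclicFE raddf_sum; apply: eq_bigr => l _ /=; rewrite mcoeffX.
Qed.

Lemma soc_dhomog d f : d != 4%N -> f \is d.-homog -> soc f = 0.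
Proof.
move=> d_neq4 /dhomogP f_homog;
  rewrite (mpolyE f) linear_sum /= big_seq big1 // => m m_f.
rewrite linearZ /= soc_mon mcoeff_cyclicF big1 ?mulr0 // => l _.
by case: eqP => // eq_m; move: d_neq4;
  rewrite -(f_homog m m_f) -eq_m /= mdeg_fterm.
Qed.

Lemma fterm_supp l i :
  (0 < fterm l i)%N -> [\/ i = l, i = l + 1 | i = l + 2].
Proof.
rewrite ftermE; case: (eqVneq l i) => [->|_]; first by constructor 1.
case: (eqVneq (l + 1) i) => [->|_]; first by constructor 2.
by case: (eqVneq (l + 2) i) => [->|_]; first by constructor 3.
Qed.

(** Every term of F is supported on three consecutive indices, hence none is divisible by y_i
    y_j. *)
Lemma soc_far h i j : far i j -> soc (h * ('X_i * 'X_j)) = 0.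
Proof.
move=> far_ij; apply: soc_mul_eq0 => m.
rewrite -!mpolyXD soc_mon mcoeff_cyclicF big1 // => l _.
case: eqP => // eq_l.
have /fterm_supp l_i : (0 < fterm l i)%N.
  by rewrite eq_l !mnmDE !mnm1E eqxx addnCA.
have /fterm_supp l_j : (0 < fterm l j)%N.
  by rewrite eq_l !mnmDE !mnm1E eqxx addnA addn1.
by case: l_i l_j far_ij => -> [] ->; rewrite /far; ord_decide.
Qed.

Lemma fterm_square l i : (1 < fterm l i)%N -> i = l + 2.
Proof.
rewrite ftermE; case: (eqVneq (l + 2) i) => [-> //|_].
by case: (eqVneq l i) => [<-|_]; ord_decide => //; case: (eqVneq (l + 1) i).
Qed.

Lemma mcoeff_cyclicF1 l (m : 'X_{1..c}) :
  (forall l', fterm l' = m -> l' = l) -> F@_m = (fterm l == m)%:R.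
Proof.
move=> l_uniq; rewrite mcoeff_cyclicF (bigD1 l) //= big1 ?addr0 // => l' l'_neq.
by case: eqP => // /l_uniq eq_l; rewrite eq_l eqxx in l'_neq.
Qed.

(** A term of F divisible by y_(i+3)^2 must be the one at i + 1, and one divisible by y_i y_(i+2)
    must be the one at i. Both leave the cofactor y_(i+1) y_(i+2), so the two contributions
    cancel. *)
Lemma soc_sq h i :
  soc (h * ('X_(i + 3) * 'X_(i + 3) - 'X_i * 'X_(i + 2))) = 0.
Proof.
apply: soc_mul_eq0 => m; rewrite mulrBr linearB /= -!mpolyXD !soc_mon.
rewrite (@mcoeff_cyclicF1 (i + 1)) ?(@mcoeff_cyclicF1 i).
- have -> : fterm (i + 1) =
      (U_((i + 1)%R) + U_((i + 2)%R) + (U_((i + 3)%R) + U_((i + 3)%R)))%MM.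
    rewrite /fterm (_ : i + 1 + 1 = i + 2); last by ring.
    by rewrite (_ : i + 1 + 2 = i + 3) //; ring.
  have -> : fterm i =
      (U_((i + 1)%R) + U_((i + 2)%R) + (U_(i) + U_((i + 2)%R)))%MM.
    by apply/mnmP => j; rewrite /fterm !mnmDE addnACA addnC.
  by rewrite !eqm_add2r subrr.
- move=> l eq_l.
  have /fterm_supp l_i : (0 < fterm l i)%N.
    by rewrite eq_l !mnmDE !mnm1E eqxx addnCA.
  have /fterm_supp l_i2 : (0 < fterm l (i + 2)%R)%N.
    by rewrite eq_l !mnmDE !mnm1E eqxx !addnA addn1.
  by case: l_i l_i2 => -> // [] /eqP; ord_decide.
- move=> l eq_l.
  have /fterm_square : (1 < fterm l (i + 3)%R)%N.
    by rewrite eq_l !mnmDE !mnm1E eqxx addnA !addn1.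
  by move=> i3; apply: (addIr 2); rewrite -i3; ring.
Qed.

Lemma soc_Emon : soc (Emon (fun i => 'X_i)) = 1.
Proof.
rewrite /Emon /Tmon !add0r -!mpolyXD soc_mon (@mcoeff_cyclicF1 0).
  by rewrite /fterm !add0r mulmS mulm1n addmA eqxx.
move=> l eq_l; have /fterm_square : (1 < fterm l (0 + 2)%R)%N.
  by rewrite eq_l !add0r !mnmDE !mnm1E eqxx !addn1.
by move/addIr.
Qed.

End Socle.

(** * The monomial basis and its duality *)

(** The six summands label 1, X, U, V, T and E in this order; a sum type inherits its finite
    structure and splits big operators by kind. *)
Definition basis_index (n : nat) : Type :=
  ((unit + 'I_n) + ('I_n + 'I_n) + ('I_n + unit))%type.
HB.instance Definition _ n := Finite.on (basis_index n).

Section Basis.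
Variables (n : nat).
Local Notation c := n.+4.+3.
Local Notation Z := 'I_c.
Implicit Types t s : basis_index c.

Definition I0 : basis_index c := inl (inl (inl tt)).
Definition IX i : basis_index c := inl (inl (inr i)).
Definition IU i : basis_index c := inl (inr (inl i)).
Definition IV i : basis_index c := inl (inr (inr i)).
Definition IT i : basis_index c := inr (inl i).
Definition IE : basis_index c := inr (inr tt).

Variant basis_spec : basis_index c -> Type :=
| Basis0 : basis_spec I0
| BasisX i : basis_spec (IX i)
| BasisU i : basis_spec (IU i)
| BasisV i : basis_spec (IV i)
| BasisT i : basis_spec (IT i)
| BasisE : basis_spec IE.

Lemma basisP t : basis_spec t.
Proof. by case: t => [[[[]|i]|[i|i]]|[i|[]]]; constructor. Qed.

Definition bdeg t : nat :=
  match t with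
  | inl (inl (inl _)) => 0
  | inl (inl (inr _)) => 1
  | inl (inr _) => 2
  | inr (inl _) => 3
  | inr (inr _) => 4
  end.

Definition dual t : basis_index c :=
  match t with
  | inl (inl (inl _)) => IE
  | inl (inl (inr i)) => IT (i - 2)
  | inl (inr (inl i)) => IV (i - 1)
  | inl (inr (inr i)) => IU (i + 1)
  | inr (inl i) => IX (i + 2)
  | inr (inr _) => I0
  end.

Lemma bdeg_dual t : (bdeg (dual t) + bdeg t = 4)%N.
Proof. by case: (basisP t). Qed.

Definition std_mon (A : comNzRingType) (X : Z -> A) t : A :=
  match t with
  | inl (inl (inl _)) => 1
  | inl (inl (inr i)) => X i
  | inl (inr (inl i)) => Umon X i
  | inl (inr (inr i)) => Vmon X i
  | inr (inl i) => Tmon X i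
  | inr (inr _) => Emon X
  end.

Lemma rmorph_basis (A B : comNzRingType) (phi : {rmorphism A -> B}) X t :
  phi (std_mon X t) = std_mon (phi \o X) t.
Proof.
by case: (basisP t) => [|i|i|i|i|];
  rewrite /= ?rmorph1 // /Umon /Vmon /Emon /Tmon ?rmorphM.
Qed.

End Basis.

(** Common interface of S/J and S/I_F from which the structural results follow. [soc_basisM] carries
    the grading, and [mulX_ind] says that the X_i generate A as an algebra. *)
Record cyclic_frobenius (k : fieldType) (n : nat) (A : comAlgType k)
    (X : 'I_n.+4.+3 -> A) (soc : {scalar A}) : Prop := CyclicFrobenius {
  X_far : forall i j, far i j -> X i * X j = 0;
  X_sq : forall i, X (i + 3) * X (i + 3) = X i * X (i + 2);
  soc_basisM : forall t s : basis_index n.+4.+3,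
    (bdeg t + bdeg s != 4)%N -> soc (std_mon X t * std_mon X s) = 0;
  soc_IE : soc (std_mon X (IE n)) = 1;
  mulX_ind : forall P : A -> Prop,
    (forall a x y, P x -> P y -> P (a *: x + y)) -> P 1 ->
    (forall i x, P x -> P (X i * x)) -> forall x, P x
}.

Section FrobeniusForm.
Variables (k : fieldType) (n : nat) (A : comAlgType k).
Local Notation c := n.+4.+3.
Local Notation Z := 'I_c.
Variables (X : Z -> A) (soc : {scalar A}).
Local Notation b := (std_mon X).
Implicit Types (t s : basis_index c) (x y : A).
Hypothesis frobX : cyclic_frobenius X soc.

Let mulXX := mulXX (X_far frobX) (X_sq frobX).
Let mulXU := mulXU (X_far frobX) (X_sq frobX).
Let mulXV := mulXV (X_far frobX) (X_sq frobX).
Let mulXT := mulXT (X_far frobX) (X_sq frobX).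
Let mulXE := mulXE (X_far frobX) (X_sq frobX).
Let mulUU := mulUU (X_far frobX) (X_sq frobX).
Let mulVV := mulVV (X_far frobX) (X_sq frobX).
Let mulVU := mulVU (X_far frobX) (X_sq frobX).

Lemma soc_dual t s : soc (b (dual t) * b s) = (t == s)%:R.
Proof.
have [eq_deg|neq_deg] := eqVneq (bdeg t) (bdeg s); last first.
  rewrite (soc_basisM frobX); last by rewrite -(bdeg_dual t) eqn_add2l eq_sym.
  by case: (t =P s) neq_deg => // ->; rewrite eqxx.
case: (basisP t) eq_deg => [|i|i|i|i|]; case: (basisP s) => [|j|j|j|j|] //= _.
- by rewrite mulr1 (soc_IE frobX).
- rewrite mulrC mulXT subrK linearMn /= (soc_IE frobX).
  by rewrite [IX _ == _]/eq_op /= eq_sym.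
- by rewrite mulVU subrK linearMn /= (soc_IE frobX) [IU _ == _]/eq_op /= eq_sym.
- by rewrite mulVV linear0.
- by rewrite mulUU linear0.
- rewrite mulrC mulVU (inj_eq (addIr 1)) linearMn /= (soc_IE frobX).
  by rewrite [IV _ == _]/eq_op.
- rewrite mulXT (inj_eq (addIr 2)) linearMn /= (soc_IE frobX).
  by rewrite [IT _ == _]/eq_op.
- by rewrite mul1r (soc_IE frobX).
Qed.

Definition expand x : A := \sum_t soc (b (dual t) * x) *: b t.

Fact expand_is_linear : linear expand.
Proof.
move=> a x y; rewrite /expand scaler_sumr -big_split; apply: eq_bigr => t _ /=.
by rewrite mulrDr -scalerAr linearP scalerDl scalerA.
Qed.

HB.instance Definition _ := GRing.isLinear.Build k A A *:%R expand
  expand_is_linear.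

Lemma expand_basis t : expand (b t) = b t.
Proof.
rewrite /expand (bigD1 t) //= soc_dual eqxx scale1r big1 ?addr0 // => s ne_st.
by rewrite soc_dual (negbTE ne_st) scale0r.
Qed.

(** [expand] is linear and fixes the basis by duality. The span of the basis contains 1 and, by the
    multiplication table, is stable under each X_j, so it is all of A. *)
Lemma expandE x : expand x = x.
Proof.
elim/(mulX_ind frobX): x => [a x y ex ey||j x ex].
- by rewrite expand_is_linear ex ey.
- exact: (expand_basis (I0 n)).
have eX i : expand (X i) = X i := expand_basis (IX i).
have eU i : expand (Umon X i) = Umon X i := expand_basis (IU i).
have eV i : expand (Vmon X i) = Vmon X i := expand_basis (IV i).
have eT i : expand (Tmon X i) = Tmon X i := expand_basis (IT i).
have eE : expand (Emon X) = Emon X := expand_basis (IE n).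
have [f ->] : exists f, x = \sum_t f t *: b t.
  by exists (fun t => soc (b (dual t) * x)).
rewrite mulr_sumr linear_sum; apply: eq_bigr => t _ /=.
rewrite -scalerAr linearZ /=; congr (_ *: _).
case: (basisP t) => [|i|i|i|i|] /=.
- by rewrite mulr1 eX.
- by rewrite mulXX !linearD /= !linearMn /= !eU !eV.
- by rewrite mulXU !linearD /= !linearMn /= !eT.
- by rewrite mulXV !linearD /= !linearMn /= !eT.
- by rewrite mulXT !linearMn /= !eE.
- by rewrite mulXE linear0.
Qed.

Definition coef t x : k := soc (b (dual t) * x).

Fact coef_is_scalar t : scalar (coef t).
Proof. by move=> a x y; rewrite /coef mulrDr -scalerAr linearP. Qed.

HB.instance Definition _ t :=
  GRing.isLinear.Build k A k *%R (coef t) (coef_is_scalar t).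

Lemma coef_expansion x : x = \sum_t coef t x *: b t.
Proof. by rewrite -{1}[x]expandE. Qed.

Lemma coef_basis t s : coef t (b s) = (t == s)%:R.
Proof. exact: soc_dual. Qed.

Lemma coef_one t : coef t 1 = (t == I0 n)%:R.
Proof. exact: (coef_basis t (I0 n)). Qed.

(** In this lemma and the next three, X_j is moved onto the dual monomial inside the form, where the
    multiplication table applies. *)
Lemma coef0_mulX j x : coef (I0 n) (X j * x) = 0.
Proof. by rewrite /coef /= mulrCA mulrA mulXE mul0r linear0. Qed.

Lemma coefX_mulX i j x : coef (IX i) (X j * x) = coef (I0 n) x *+ (j == i).
Proof. by rewrite /coef /= mulrCA mulrA mulXT subrK mulrnAl linearMn. Qed.

Lemma coefU_mulX i j x : coef (IU i) (X j * x) =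
  coef (IX (i + 1)) x *+ (j == i) + coef (IX i) x *+ (j == i + 1).
Proof.
rewrite /coef /= mulrCA mulrA mulXV mulrDl !mulrnAl linearD /= !linearMn /=.
have -> : i - 1 + 1 = i by ring.
have -> : i - 1 + 2 = i + 1 by ring.
have -> : i - 1 - 1 = i - 2 by ring.
by have -> : i + 1 - 2 = i - 1 by ring.
Qed.

Lemma coefV_mulX i j x : coef (IV i) (X j * x) =
  coef (IX (i + 2)) x *+ (j == i) + coef (IX i) x *+ (j == i + 2)
  + coef (IX (i + 3)) x *+ (j == i + 3).
Proof.
rewrite /coef /= mulrCA mulrA mulXU !mulrDl !mulrnAl !linearD /= !linearMn /=.
rewrite addrAC.
have -> : i + 1 - 1 = i by ring.
have -> : i + 1 + 1 = i + 2 by ring.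
have -> : i + 1 + 2 = i + 3 by ring.
have -> : i + 1 - 3 = i - 2 by ring.
have -> : i + 2 - 2 = i by ring.
by have -> : i + 3 - 2 = i + 1 by ring.
Qed.

Lemma coef_cstM x y : coef (I0 n) (x * y) = coef (I0 n) x * coef (I0 n) y.
Proof.
elim/(mulX_ind frobX): x => [a x1 x2 e1 e2||j x _].
- by rewrite mulrDl -scalerAl !linearP /= e1 e2; ring.
- by rewrite mul1r coef_one eqxx mul1r.
- by rewrite -mulrA !coef0_mulX mul0r.
Qed.

Lemma coef_linM i x y : coef (IX i) (x * y) =
  coef (I0 n) x * coef (IX i) y + coef (IX i) x * coef (I0 n) y.
Proof.
elim/(mulX_ind frobX): x => [a x1 x2 e1 e2||j x _].
- by rewrite mulrDl -scalerAl !linearP /= e1 e2; ring.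
- by rewrite mul1r !coef_one eqxx mul1r mul0r addr0.
- rewrite -mulrA !coefX_mulX coef0_mulX coef_cstM; case: (j == i); ring.
Qed.

(** Dual comultiplication: U_i arises only as 1 U_i, U_i 1 and the two orders of X_i X_(i+1). *)
Lemma coef_UM i x y : coef (IU i) (x * y) =
  coef (I0 n) x * coef (IU i) y + coef (IU i) x * coef (I0 n) y
  + coef (IX i) x * coef (IX (i + 1)) y + coef (IX (i + 1)) x * coef (IX i) y.
Proof.
elim/(mulX_ind frobX): x => [a x1 x2 e1 e2||j x _].
- by rewrite mulrDl -scalerAl !linearP /= e1 e2; ring.
- by rewrite mul1r !coef_one eqxx !mul0r !addr0 mul1r.
- rewrite -mulrA !coefU_mulX !coefX_mulX coef0_mulX !coef_linM.
  by case: (j == i); case: (j == i + 1); ring.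
Qed.

(** The last summand reflects the second factorization V_i = X_(i+3)^2. *)
Lemma coef_VM i x y : coef (IV i) (x * y) =
  coef (I0 n) x * coef (IV i) y + coef (IV i) x * coef (I0 n) y
  + coef (IX i) x * coef (IX (i + 2)) y + coef (IX (i + 2)) x * coef (IX i) y
  + coef (IX (i + 3)) x * coef (IX (i + 3)) y.
Proof.
elim/(mulX_ind frobX): x => [a x1 x2 e1 e2||j x _].
- by rewrite mulrDl -scalerAl !linearP /= e1 e2; ring.
- by rewrite mul1r !coef_one eqxx !mul0r !addr0 mul1r.
- rewrite -mulrA !coefV_mulX !coefX_mulX coef0_mulX !coef_linM.
  by case: (j == i); case: (j == i + 2); case: (j == i + 3); ring.
Qed.

End FrobeniusForm.

Arguments coef : simpl never.

(** * The quotients S/I with I between J and I_F *)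

Section Quotient.
Variables (k : fieldType) (n : nat).
Local Notation c := n.+4.+3.
Local Notation Z := 'I_c.
Local Notation S := {mpoly k[c]}.
Variable I : idealr S.
Hypothesis I_far : forall i j : Z, far i j -> 'X_i * 'X_j \in I.
Hypothesis I_sq : forall i : Z,
  'X_(i + 3) * 'X_(i + 3) - 'X_i * 'X_(i + 2) \in I.
Hypothesis soc_I : forall f, f \in I -> soc f = 0.
Local Notation Q := {ideal_quot I}.
Local Notation pi := (\pi_Q).
Implicit Types t s : basis_index c.

Definition qX (i : Z) : Q := pi 'X_i.
Local Notation b := (std_mon qX).

Lemma qX_far i j : far i j -> qX i * qX j = 0.
Proof.
by move=> /I_far ij; rewrite /qX -rmorphM -(rmorph0 pi); apply/eqP;
  rewrite -Quotient.idealrBE subr0.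
Qed.

Lemma qX_sq i : qX (i + 3) * qX (i + 3) = qX i * qX (i + 2).
Proof.
by rewrite /qX -!rmorphM; apply/eqP; rewrite -Quotient.idealrBE I_sq.
Qed.

Definition qsoc (x : Q) : k := soc (repr x).

Lemma qsoc_pi f : qsoc (pi f) = soc f.
Proof.
apply/eqP; rewrite -subr_eq0 -linearB /=; apply/eqP/soc_I.
by rewrite Quotient.idealrBE reprK.
Qed.

Lemma pi_scale a f : pi (a *: f) = a *: pi f.
Proof. by rewrite -mulr_algl rmorphM. Qed.

Lemma piP (P : Q -> Prop) : (forall f, P (pi f)) -> forall x, P x.
Proof. by move=> Ppi x; rewrite -[x]reprK. Qed.

Fact qsoc_is_scalar : scalar qsoc.
Proof.
move=> a; elim/piP => f; elim/piP => g.
by rewrite -pi_scale -rmorphD /= !qsoc_pi linearP.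
Qed.

HB.instance Definition _ := GRing.isLinear.Build k Q k *%R qsoc qsoc_is_scalar.

Lemma pi_basis t : pi (std_mon (fun i => 'X_i) t) = b t.
Proof. exact: rmorph_basis. Qed.

Lemma basis_dhomog t : std_mon (fun i : Z => 'X_i : S) t \is (bdeg t).-homog.
Proof.
have XH (i : Z) : ('X_i : S) \is 1.-homog by rewrite dhomogX /= mdeg1.
case: (basisP t) => [|i|i|i|i|] //=; first exact: dhomog1.
- exact: (dhomogM (XH _) (XH _)).
- exact: (dhomogM (XH _) (XH _)).
- exact: (dhomogM (dhomogM (XH _) (XH _)) (XH _)).
- exact: (dhomogM (dhomogM (dhomogM (XH _) (XH _)) (XH _)) (XH _)).
Qed.

Lemma qsoc_basisM t s : (bdeg t + bdeg s != 4)%N -> qsoc (b t * b s) = 0.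
Proof.
move=> ne4; rewrite -!pi_basis -rmorphM /= qsoc_pi.
by apply: soc_dhomog ne4 _; apply: dhomogM; apply: basis_dhomog.
Qed.

Lemma qsoc_IE : qsoc (b (IE n)) = 1.
Proof. by rewrite -pi_basis qsoc_pi soc_Emon. Qed.

Lemma qX_ind (P : Q -> Prop) :
  (forall a x y, P x -> P y -> P (a *: x + y)) -> P 1 ->
  (forall i x, P x -> P (qX i * x)) -> forall x, P x.
Proof.
move=> Plin P1 PX.
have P0 : P 0 by have := Plin (-1) 1 1 P1 P1; rewrite scaleN1r addNr.
(* The polynomials whose multiplication preserves P are closed under products and contain the
   variables, hence all monomials. *)
pose K g := forall x, P x -> P (pi g * x).
have KM g h : K g -> K h -> K (g * h).
  by move=> Kg Kh x Px; rewrite rmorphM -mulrA; apply/Kg/Kh.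
have K1 : K 1 by move=> x Px; rewrite rmorph1 mul1r.
have Kmon m : K 'X_[m].
  rewrite mpolyXE_id; apply: big_ind => // i _.
  elim: (m i) => [|e IHe]; first by rewrite expr0.
  by rewrite exprS; apply: KM => // x Px; apply: PX.
elim/piP => f; elim/mpolyind: f => [|a m f _ _ IHf]; first by rewrite rmorph0.
rewrite rmorphD /= pi_scale; apply: Plin => //.
by rewrite -[pi 'X_[m]]mulr1; apply: Kmon.
Qed.

Lemma quotient_frobenius : cyclic_frobenius qX qsoc.
Proof.
by split; [exact: qX_far | exact: qX_sq | exact: qsoc_basisM | exact: qsoc_IE |
  exact: qX_ind].
Qed.

(** If f has degree d, its product with the dual of t has degree 4 - [bdeg t] + d, and [soc] sees
    only degree 4. Conversely, the basis expansion lifts to a homogeneous polynomial. *)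
Lemma quot_grP d x :
  quot_gr d x <-> forall t, bdeg t != d -> coef qX qsoc t x = 0.
Proof.
split=> [[f [f_homog ->]] t t_d|x_d].
  rewrite /coef -pi_basis -rmorphM /= qsoc_pi.
  apply: soc_dhomog (dhomogM (basis_dhomog _) f_homog).
  by rewrite -(bdeg_dual t) eqn_add2l eq_sym.
pose m := std_mon (fun i : Z => 'X_i : S).
exists (\sum_(t | bdeg t == d) coef qX qsoc t x *: m t); split.
  apply: rpred_sum => t /eqP <-; apply/rpredZ/basis_dhomog.
rewrite {1}(coef_expansion quotient_frobenius x) raddf_sum [RHS]big_mkcond.
apply: eq_bigr => t _ /=; case: ifP => [_|/negbT t_d];
  last by rewrite x_d ?scale0r.
by rewrite pi_scale pi_basis.
Qed.

End Quotient.

(** * Generation by quadrics *)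

Section Quadratic.
Variables (k : fieldType) (n : nat).
Local Notation c := n.+4.+3.
Local Notation Z := 'I_c.
Local Notation S := {mpoly k[c]}.
Local Notation F := (cyclicF k c).
Hypothesis F_neq0 : F != 0.
Local Notation I_F := (annihilator F_neq0).

Variant quadric : S -> Prop :=
| QuadricFar (i j : Z) of far i j : quadric ('X_i * 'X_j)
| QuadricSq (i : Z) : quadric ('X_(i + 3) * 'X_(i + 3) - 'X_i * 'X_(i + 2)).

Lemma quadric_dhomog q : quadric q -> q \is 2.-homog.
Proof.
have XX (i j : Z) : ('X_i * 'X_j : S) \is 2.-homog.
  have XH (l : Z) : ('X_l : S) \is 1.-homog by rewrite dhomogX /= mdeg1.
  exact: (dhomogM (XH i) (XH j)).
by case=> [i j _|i]; [|apply: rpredB].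
Qed.

Lemma quadric_annihilator q : quadric q -> q \in I_F.
Proof.
by case=> [i j far_ij|i]; apply/mem_annihilatorP => h;
  [exact: soc_far | exact: soc_sq].
Qed.

Lemma soc_annihilator f : f \in I_F -> soc f = 0.
Proof. by move=> /mem_annihilatorP /(_ 1); rewrite mul1r. Qed.

Lemma ideal_genW (A : comNzRingType) (P : A -> Prop) q : P q -> ideal_gen P q.
Proof.
move=> Pq; exists [:: (1, q)]; split; last by rewrite big_seq1 mul1r.
by move=> t; rewrite inE => /eqP ->.
Qed.

Lemma ideal_gen_lin (A : comNzRingType) (P : A -> Prop) a u v :
  ideal_gen P u -> ideal_gen P v -> ideal_gen P (a * u + v).
Proof.
move=> [r [Pr ->]] [s [Ps ->]].
exists ([seq (a * t.1, t.2) | t <- r] ++ s); split=> [t|].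
  by rewrite mem_cat => /orP[/mapP[t' /Pr Pt' ->]|/Ps].
rewrite big_cat big_map mulr_sumr; congr (_ + _).
by apply: eq_bigr => t _; rewrite mulrA.
Qed.

Lemma ideal_gen_sub (P : S -> Prop) (I : idealr S) :
  (forall q, P q -> q \in I) -> forall f, ideal_gen P f -> f \in I.
Proof.
move=> PI f [s [Ps ->]]; rewrite big_seq; apply: rpred_sum => t /Ps /PI.
exact: idealMr.
Qed.

(** The ideal J, made a boolean predicate classically so that S/J can be formed. *)
Definition quadric_ideal : {pred S} :=
  fun f => boolp.asbool (ideal_gen quadric f).

Lemma quadric_idealP f : reflect (ideal_gen quadric f) (f \in quadric_ideal).
Proof. exact: boolp.asboolP. Qed.

Fact quadric_ideal_closed : idealr_closed quadric_ideal.
Proof.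
split=> [||a u v /quadric_idealP u_q /quadric_idealP v_q].
- by apply/quadric_idealP; exists [::]; rewrite big_nil.
- apply/negP => /quadric_idealP /(ideal_gen_sub quadric_annihilator).
  by rewrite idealr1.
- exact/quadric_idealP/ideal_gen_lin.
Qed.

HB.instance Definition _ := isIdealr.Build S quadric_ideal quadric_ideal_closed.

Lemma quadric_ideal_sub f : f \in quadric_ideal -> f \in I_F.
Proof. by move/quadric_idealP/(ideal_gen_sub quadric_annihilator). Qed.

(** For f in I_F, each coordinate of its class in S/J is a value [soc (h * f)], hence zero; so f
    lies in J. *)
Lemma annihilator_quadratic : quadratic_ideal (fun f => f \in I_F).
Proof.
exists quadric; split; first exact: quadric_dhomog.
move=> f; split; last exact: (ideal_gen_sub quadric_annihilator).
move=> f_ann; apply/quadric_idealP.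
have J_far (i j : Z) : far i j -> 'X_i * 'X_j \in quadric_ideal.
  by move=> far_ij; apply/quadric_idealP/ideal_genW; constructor.
have J_sq (i : Z) :
    'X_(i + 3) * 'X_(i + 3) - 'X_i * 'X_(i + 2) \in quadric_ideal.
  by apply/quadric_idealP/ideal_genW; constructor.
have soc_J g : g \in quadric_ideal -> soc g = 0.
  by move/quadric_ideal_sub/soc_annihilator.
suff f0 : \pi_{ideal_quot quadric_ideal} f = 0.
  rewrite -[f]subr0 Quotient.idealrBE; apply/eqP.
  by rewrite f0 rmorph0.
rewrite (coef_expansion (quotient_frobenius J_far J_sq soc_J) (\pi f)) big1 //
  => t _.
rewrite /coef -pi_basis -rmorphM /= qsoc_pi //.
by move/mem_annihilatorP: f_ann => ->; rewrite scale0r.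
Qed.

End Quadratic.

(** * The h-vector *)

Lemma card_bdeg n d : #|[pred t : basis_index n.+4.+3 | bdeg t == d]| =
  nth 0%N [:: 1; n.+4.+3; 2 * n.+4.+3; n.+4.+3; 1]%N d.
Proof.
have sum_const (T : finType) (e : bool) : (\sum_(i : T | e) 1 = e * #|T|)%N.
  by case: e; rewrite ?big_pred0_eq // mul1n -sum1_card.
rewrite -sum1_card !big_sumType /= !(sum_const unit) !(sum_const 'I__)
  card_unit card_ord.
(* Beyond degree 4 both sides are 0, the right one as the default value of [nth]. *)
by do 5?case: d => [|d];
  rewrite /= ?mul1n ?addn0 ?add0n ?addnn ?mul2n // [RHS]nth_nil.
Qed.

Section Graded.
Variables (k : fieldType) (n : nat) (A : comAlgType k).
Local Notation c := n.+4.+3.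
Local Notation Z := 'I_c.
Variables (X : Z -> A) (soc : {scalar A}) (gr : nat -> A -> Prop).
Hypothesis frobX : cyclic_frobenius X soc.
Local Notation b := (std_mon X).
Local Notation coef := (coef X soc).
Hypothesis grP :
  forall d x, gr d x <-> forall t, bdeg t != d -> coef t x = 0.

Lemma has_dim_gr d : has_dim (gr d) #|[pred t : basis_index c | bdeg t == d]|.
Proof.
have coef_sum (a : 'I_#|[pred t : basis_index c | bdeg t == d]| -> k) t :
    coef t (\sum_i a i *: b (enum_val i)) = \sum_i a i * (t == enum_val i)%:R.
  rewrite linear_sum; apply: eq_bigr => i _ /=.
  by rewrite linearZ /= coef_basis.
exists (fun i => b (enum_val i)); split=> [w|a sum0 i].
  split=> [/grP w_d|[a ->]].
    exists (fun i => coef (enum_val i) w).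
    rewrite {1}(coef_expansion frobX w) (bigID [pred t | bdeg t == d]) /=.
    rewrite [X in _ + X]big1 ?addr0 => [|t /w_d ->]; last by rewrite scale0r.
    by rewrite -(big_enum_val (fun t => coef t w *: b t)).
  apply/grP => t t_d; rewrite coef_sum big1 // => i _.
  case: eqP => [et|_]; last by rewrite mulr0.
  by have := enum_valP i; rewrite inE -et (negbTE t_d).
have := coef_sum a (enum_val i); rewrite sum0 linear0 (bigD1 i) //= eqxx mulr1.
rewrite big1 ?addr0 // => j ne_ji.
by rewrite (inj_eq enum_val_inj) eq_sym (negbTE ne_ji) mulr0.
Qed.

Lemma prime_augmentation : is_prime (fun x => coef (I0 n) x = 0).
Proof.
split=> [||x y].
- split=> [|x y x0 y0|a x x0]; first exact: linear0.
    by rewrite linearD /= x0 y0 addr0.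
  by rewrite (coef_cstM frobX) x0 mulr0.
- by rewrite (coef_one frobX) eqxx => /eqP; rewrite oner_eq0.
- by move/eqP; rewrite (coef_cstM frobX) mulf_eq0 => /orP[]/eqP; [left | right].
Qed.

(** Every X_i has cube zero and so lies in P. Hence P contains the kernel of the augmentation, and
    an element with nonzero constant term would put 1 in P. *)
Lemma prime_unique P : is_prime P -> forall x, P x <-> coef (I0 n) x = 0.
Proof.
move=> [[P0 PD PM] P1 Pprime].
have PX i : P (X i).
  have : P (X i * (X i * X i)).
    rewrite (mulXX (X_far frobX) (X_sq frobX)) !mulrDr !mulrnAr.
    rewrite !(mulXV (X_far frobX) (X_sq frobX)).
    by ord_decide; rewrite ?mulr0n ?addr0.
  by case/Pprime => // /Pprime[].
have Paug x : P (x - coef (I0 n) x *: 1).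
  elim/(mulX_ind frobX): x => [a x y Px Py||i x _].
  - rewrite linearP /= scalerDl -scalerA opprD addrACA -scalerBr.
    by apply: PD => //; rewrite -[a *: _]mulr_algl; apply: PM.
  - by rewrite (coef_one frobX) eqxx scale1r subrr.
  - by rewrite (coef0_mulX frobX) scale0r subr0 mulrC; apply: PM.
move=> x; split=> [Px|x0]; last by have := Paug x; rewrite x0 scale0r subr0.
apply/eqP/negP => /negP x_neq0; apply: P1.
have -> : 1 = (coef (I0 n) x)^-1%:A * (x + (- 1) * (x - coef (I0 n) x *: 1)).
  by rewrite mulN1r opprB addrC subrK mulr_algl scalerA mulVf ?scale1r.
by apply/PM/PD => //; apply: PM.
Qed.

Lemma krull_dim0 : krull_dim A 0.
Proof.
split.
  by exists (fun _ x => coef (I0 n) x = 0); split=> // i _;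
    exact: prime_augmentation.
case=> p [p_prime p_lt]; have [_ [x [p1x p0x]]] := p_lt 0%N isT.
apply/p0x/(prime_unique (p_prime 0%N isT)).
exact/(prime_unique (p_prime 1%N isT)).
Qed.

Lemma h_vector_gr : h_vector gr [:: 1; c%:Z; (2 * c)%:Z; c%:Z; 1].
Proof.
exists 0%N, (fun d => #|[pred t : basis_index c | bdeg t == d]|).
split=> [|||d]; [exact: krull_dim0 | exact: has_dim_gr | by [] |].
rewrite big_ord_recl big1 => [|j _]; last by rewrite expr0 coef1 mul0r.
rewrite expr0 coef1 mul1r addr0 subn0 card_bdeg.
by do 5?case: d => [//|d]; rewrite ![nth _ _ _]nth_nil.
Qed.

End Graded.

(** * Self-injectivity *)

Section FunctionalExtension.
Variables (k : fieldType) (A : comAlgType k) (N : lmodType A).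

(** M carries only its A-module structure, so k acts through [a%:A]. *)
Definition klinear (M : lmodType A) (phi : M -> k) : Prop :=
  forall a x y, phi (a%:A *: x + y) = a * phi x + phi y.

(* Partial functionals on [N], represented by their graphs. *)
Definition partial_functional (G : N * k -> Prop) : Prop :=
  [/\ forall a x y u v, G (x, u) -> G (y, v) -> G (a%:A *: x + y, a * u + v)
    & forall u, G (0, u) -> u = 0].

Lemma partial_functional_total (G0 : N * k -> Prop) :
  G0 (0, 0) -> partial_functional G0 ->
  exists theta : N -> k, klinear theta /\ forall x u, G0 (x, u) -> theta x = u.
Proof.
move=> G00 G0_pf.
have algA a a' (x : N) : a%:A *: (a'%:A *: x) = (a * a')%:A *: x.
  by rewrite scalerA mulr_algl scalerA.
(* The nonemptiness premise lets the union of the empty chain satisfy [P] in Zorn's lemma. *)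
pose P G := (exists z, G z) -> partial_functional G /\ forall z, G0 z -> G z.
have [F F_P F_chain|G [PG G_max]] := @classical_sets.Zorn_bigcup (N * k) P.
  case=> z0 [G1 FG1 G1z0].
  have FP G : F G -> (exists z, G z) ->
      partial_functional G /\ forall z, G0 z -> G z.
    exact: F_P.
  have [_ sub1] := FP G1 FG1 (ex_intro _ _ G1z0).
  split; last by move=> z /sub1 G1z; exists G1.
  split=> [a x y u v [G FG Gx] [G' FG' Gy]|u [G FG Gu]].
    have [sGG'|sG'G] := F_chain G G' FG FG'.
      have [[lin _] _] := FP G' FG' (ex_intro _ _ Gy).
      by exists G' => //; apply: lin => //; apply: sGG'.
    have [[lin _] _] := FP G FG (ex_intro _ _ Gx).
    by exists G => //; apply: lin => //; apply: sG'G.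
  by have [[_ fun_G] _] := FP G FG (ex_intro _ _ Gu); apply: fun_G.
have Gnonempty : exists z, G z.
  case: (boolp.pselect (exists z, G z)) => // G_empty; exfalso.
  apply: (G_max G0) => [|_]; last by [].
  split=> [z Gz|G0G]; first by case: G_empty; exists z.
  by apply: G_empty; exists (0, 0); apply: G0G.
have [[lin fun0] subG0] := PG Gnonempty.
have G_0 : G (0, 0) by apply: subG0.
have Gfun x u v : G (x, u) -> G (x, v) -> u = v.
  move=> Gu Gv; apply/eqP; rewrite -subr_eq0; apply/eqP/fun0.
  have := lin (- 1) x x v u Gv Gu.
  by rewrite scaleN1r scaleN1r addNr mulN1r addrC.
have Gtotal x : exists u, G (x, u).
  case: (boolp.pselect (exists u, G (x, u))) => // x_undef; exfalso.
  (* Extension by the value 0 at x. It is single-valued: a relation a x + y = 0 with a nonzero would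
     already define G at x, with value -u/a. *)
  pose G' z := exists a y, G (y, z.2) /\ z.1 = a%:A *: x + y.
  have G_G' z : G z -> G' z.
    by case: z => y u Gyu; exists 0, y; rewrite !scale0r add0r.
  apply: (G_max G').
    split; first exact: G_G'.
    move=> G'G; apply: x_undef; exists 0; apply: G'G.
    by exists 1, 0; rewrite !scale1r addr0.
  move=> _; split; last by move=> z /subG0 /G_G'.
  split=> [a y z u v [a1 [y1 [/= Gy1 ->]]] [a2 [y2 [/= Gy2 ->]]]|u].
    exists (a * a1 + a2), (a%:A *: y1 + y2); split; first exact: lin.
    by rewrite /= scalerDr !scalerDl addrACA algA.
  case=> [a [y [/= Gy ay0]]].
  have [a0|a_neq0] := eqVneq a 0.
    by move: ay0 Gy; rewrite a0 !scale0r add0r => <-; apply: fun0.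
  exfalso; apply: x_undef; exists (- a^-1 * u).
  have := lin (- a^-1) y 0 u 0 Gy G_0.
  have -> : y = - (a%:A *: x) by apply/eqP; rewrite -addr_eq0 addrC -ay0.
  by rewrite !addr0 scalerN algA mulNr mulVf // scaleN1r scaleN1r opprK.
have [theta Gtheta] := boolp.choice Gtotal.
exists theta; split=> [a x y|x u /subG0].
  exact: Gfun (Gtheta _) (lin a x y _ _ (Gtheta x) (Gtheta y)).
by move=> Gxu; apply: Gfun (Gtheta x) Gxu.
Qed.

Lemma functional_extension (M : lmodType A) (f : {linear M -> N})
    (phi : M -> k) :
  injective f -> klinear phi ->
  exists theta : N -> k, klinear theta /\ forall x, theta (f x) = phi x.
Proof.
move=> f_inj phi_lin.
have phi0 : phi 0 = 0.
  by have := phi_lin (-1) 0 0; rewrite scaler0 addr0 mulN1r addNr.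
(* The graph of phi transported to the image of f; injectivity of f makes it single-valued. *)
pose G z := exists x, z = (f x, phi x).
have G0 : G (0, 0) by exists 0; rewrite linear0 phi0.
have [|theta [theta_lin thetaG]] := @partial_functional_total G G0.
- split=> [a _ _ _ _ [x [-> ->]] [y [-> ->]]|u [x [/esym fx0 ->]]].
    by exists (a%:A *: x + y); rewrite phi_lin linearP.
  by rewrite (f_inj x 0) ?phi0 // linear0.
by exists theta; split=> // x; apply: thetaG; exists x.
Qed.

End FunctionalExtension.

Section Gorenstein.
Variables (k : fieldType) (n : nat) (A : comAlgType k).
Local Notation c := n.+4.+3.
Local Notation Z := 'I_c.
Variables (X : Z -> A) (soc : {scalar A}).
Hypothesis frobX : cyclic_frobenius X soc.
Local Notation b := (std_mon X).
Local Notation coef := (coef X soc).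
Local Notation N := #|{: basis_index c}|.

Definition of_coord (v : 'rV[k]_N) : A := \sum_i v 0 i *: b (enum_val i).
Definition to_coord (x : A) : 'rV[k]_N := \row_i coef (enum_val i) x.

Lemma to_coordK x : of_coord (to_coord x) = x.
Proof.
rewrite [RHS](coef_expansion frobX) /of_coord.
rewrite (reindex (enum_val : 'I_N -> _)) /=;
  last exact: onW_bij (enum_val_bij _).
by apply: eq_bigr => i _; rewrite mxE.
Qed.

Lemma of_coord_mul m (u : 'rV_m) (M : 'M_(m, N)) :
  of_coord (u *m M) = \sum_i u 0 i *: of_coord (row i M).
Proof.
rewrite /of_coord; under [RHS]eq_bigr => i _ do rewrite scaler_sumr.
rewrite exchange_big; apply: eq_bigr => j _ /=.
by rewrite mxE scaler_suml; apply: eq_bigr => i _; rewrite mxE scalerA.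
Qed.

(** Among matrices whose rows are coordinates of elements of J, take one of maximal rank: adjoining
    any further element of J cannot raise the rank, so its rows span J over k. *)
Lemma noetherian_frobenius : noetherian A.
Proof.
move=> J [J0 JD JM].
have JZ a x : J x -> J (a *: x) by move=> Jx; rewrite -mulr_algl; apply: JM.
have Jsum m (u : 'rV_m) (M : 'M_(m, N)) :
    (forall i, J (of_coord (row i M))) -> J (of_coord (u *m M)).
  move=> JMat; rewrite of_coord_mul; apply: big_ind => // i _; exact: JZ.
pose P r := boolp.asbool (exists M : 'M[k]_N,
  (forall i, J (of_coord (row i M))) /\ \rank M = r).
have P0 : exists r, P r.
  exists 0%N; apply/boolp.asboolP; exists 0; split; last exact: mxrank0.
  by move=> i; rewrite /of_coord big1 // => j _; rewrite !mxE scale0r.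
have P_le r : P r -> (r <= N)%N.
  by move=> /boolp.asboolP [M [_ <-]]; apply: rank_leq_row.
case: (ex_maxnP P0 P_le) => r /boolp.asboolP [M [JMat rkM]] r_max.
exists [seq of_coord (row i M) | i <- enum 'I_N] => x; split=> [Jx|].
  have /submxP[u xE] : (to_coord x <= M)%MS.
    have JMx i : J (of_coord (row i (M + to_coord x)%MS)).
      have : (row i (M + to_coord x)%MS <= col_mx M (to_coord x))%MS.
        by rewrite (submx_trans (row_sub _ _)) // addsmxE.
      case/submxP => w ->; apply: Jsum => j; rewrite -(splitK j).
      case: (split j) => j' /=; first by rewrite rowKu.
        by rewrite rowKd ord1 row_id to_coordK.
    have := r_max (\rank (M + to_coord x)%MS).
    have -> : P (\rank (M + to_coord x)%MS).
      by apply/boolp.asboolP; exists (M + to_coord x)%MS.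
    move=> /(_ isT) le_r; have := addsmxSr M (to_coord x).
    move/submx_trans; apply.
    by rewrite -(geq_leqif (mxrank_leqif_sup (addsmxSl _ _))) rkM.
  exists [seq ((u 0 i)%:A, of_coord (row i M)) | i <- enum 'I_N]; split.
    by move=> _ /mapP[i _ ->]; apply: map_f; rewrite mem_enum.
  rewrite big_map big_enum -[x]to_coordK xE of_coord_mul.
  by apply: eq_bigr => i _; rewrite mulr_algl.
case=> s [sJ ->]; rewrite big_seq; apply: big_ind => // t /sJ /mapP[i _ ->].
exact: JM.
Qed.

Lemma soc_nondegenerate x y : (forall r, soc (r * x) = soc (r * y)) -> x = y.
Proof.
move=> eq_soc; rewrite (coef_expansion frobX x) (coef_expansion frobX y).
by apply: eq_bigr => t _; congr (_ *: _); apply: eq_soc.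
Qed.

Lemma soc_represent (theta : A -> k) : scalar theta ->
  exists x, forall r, soc (r * x) = theta r.
Proof.
move=> theta_lin.
(* The coordinates of the representing element are the values of [theta] on the dual basis. *)
exists (\sum_t theta (b (dual t)) *: b t) => r.
have dualK : involutive (@dual n).
  by move=> t; case: (basisP t) => [|i|i|i|i|] //=; rewrite ?subrK ?addrK.
pose th : {scalar A} := HB.pack theta (
  GRing.isLinear.Build k A k *%R theta theta_lin).
rewrite mulr_sumr linear_sum /= -[theta r]/(th r).
rewrite [in RHS](coef_expansion frobX r) linear_sum.
rewrite (reindex_inj (inv_inj dualK)).
apply: eq_bigr => t _; rewrite -scalerAr !linearZ /= dualK mulrC.
by rewrite [r * _]mulrC.
Qed.

(** Composition with [soc] identifies A-linear maps into A with functionals. Thus soc o g extends to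
    [theta], and h y is the element representing r |-> theta (r y). Nondegeneracy gives both
    linearity of h and h o f = g. *)
Lemma self_injective : injective_module (A^o : lmodType A).
Proof.
move=> M E f g f_inj.
pose phi (x : M) := soc (g x : A).
have phi_lin : klinear phi.
  by move=> a x y; rewrite /phi linearP /= -[_ *: _]/(a%:A * (g x : A))
    mulr_algl linearP.
have [theta [theta_lin theta_f]] := functional_extension f_inj phi_lin.
have /boolp.choice[h hE] (y : E) :
    exists x, forall r, soc (r * x) = theta (r *: y).
  apply: soc_represent => a r s.
  by rewrite scalerDl -theta_lin scalerA mulr_algl.
have h_lin : linear (h : E -> A^o).
  move=> a x y; apply: soc_nondegenerate => r.
  have -> : r * (a *: (h x : A^o) + h y) = r * a * h x + r * h y.
    by rewrite mulrDr mulrA.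
  rewrite linearD /= !hE scalerDr scalerA.
  by have := theta_lin 1 ((r * a) *: x) (r *: y); rewrite mul1r !scale1r.
pose hlin := GRing.isLinear.Build A E A^o *:%R h h_lin.
pose hh : {linear E -> A^o} := HB.pack h hlin.
exists hh => x; apply: soc_nondegenerate => r.
by rewrite [LHS]hE -linearZ /= theta_f /phi linearZ /=.
Qed.

Lemma gorenstein_frobenius : gorenstein A.
Proof.
by split; [exact: noetherian_frobenius | exists 0%N; exact: self_injective].
Qed.

End Gorenstein.

(** * The obstruction to a linear resolution *)

Section NotKoszul.
Variables (k : fieldType) (n : nat) (A : comAlgType k).
Local Notation c := n.+4.+3.
Local Notation Z := 'I_c.
Variables (X : Z -> A) (soc : {scalar A}).
Hypothesis frobX : cyclic_frobenius X soc.
Local Notation b := (std_mon X).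
Local Notation coef := (coef X soc).
Local Notation kappa := (coef (I0 n)).
Local Notation g i := (coef (IX i)).
Local Notation rho i := (coef (IU i)).
Local Notation sigma i := (coef (IV i)).

Definition linear_form (x : A) : Prop := forall t, bdeg t != 1 -> coef t x = 0.

Lemma rho_sum (I : finType) (x y : I -> A) i :
  (forall l, linear_form (y l)) ->
  rho i (\sum_l x l * y l) =
  \sum_l (g i (x l) * g (i + 1) (y l) + g (i + 1) (x l) * g i (y l)).
Proof.
move=> y_lin; rewrite linear_sum; apply: eq_bigr => l _ /=.
by rewrite (coef_UM frobX) (y_lin l (I0 n)) // (y_lin l (IU i)) // !mulr0
  !add0r.
Qed.

Lemma sigma_sum (I : finType) (x y : I -> A) i :
  (forall l, linear_form (y l)) ->
  sigma i (\sum_l x l * y l) =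
  \sum_l (g i (x l) * g (i + 2) (y l) + g (i + 2) (x l) * g i (y l)
          + g (i + 3) (x l) * g (i + 3) (y l)).
Proof.
move=> y_lin; rewrite linear_sum; apply: eq_bigr => l _ /=.
by rewrite (coef_VM frobX) (y_lin l (I0 n)) // (y_lin l (IV i)) // !mulr0
  !add0r.
Qed.

(** * The first three maps of a linear resolution *)

Section Resolution.
Variables (m1 m2 m3 : nat).
Variables (D0 : 'cV[A]_m1) (D1 : 'M[A]_(m2, m1)) (D2 : 'M[A]_(m3, m2)).
Hypothesis D0_lin : forall r, linear_form (D0 r 0).
Hypothesis D1_lin : forall s r, linear_form (D1 s r).
Hypothesis D2_lin : forall q s, linear_form (D2 q s).
Hypothesis D0_gen : forall i, exists u : 'rV_m1, u *m D0 = const_mx (X i).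
Hypothesis D1_D0 : D1 *m D0 = 0.
Hypothesis D2_D1 : D2 *m D1 = 0.
Hypothesis D1_exact : forall v : 'rV_m1, v *m D0 = 0 -> exists u, v = u *m D1.
Hypothesis D2_exact : forall v : 'rV_m2, v *m D1 = 0 -> exists u, v = u *m D2.

(* Coefficients of x_i (x) x_j in D1 (x) D0 and of x_e (x) x_i (x) x_j in
   D2 (x) D1 (x) D0. *)
Definition N2 s i j : k := \sum_r g i (D1 s r) * g j (D0 r 0).
Definition N3 q e i j : k := \sum_s g e (D2 q s) * N2 s i j.

(* Pairing with a tensor in y_0, ..., y_4 whose contractions against every first
   letter lie in Rel (x) V + V (x) Rel, where V is spanned by the y_i and
   Rel = R_2^* by the y_i y_(i+1) + y_(i+1) y_i and the
   y_i y_(i+2) + y_(i+2) y_i + y_(i+3)^2. *)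
Definition obstruction (v : 'rV[A]_m2) : k :=
  \sum_s rho 0 (v 0 s) * N2 s 2 2 + \sum_s rho 1 (v 0 s) * N2 s 3 3
  + \sum_s rho 2 (v 0 s) * N2 s 4 4 + \sum_s rho 1 (v 0 s) * N2 s 0 2
  + \sum_s rho 2 (v 0 s) * N2 s 1 3 + \sum_s sigma 0 (v 0 s) * N2 s 1 2.

(** The U_i coordinate of D1 D0 = 0; [N2_sigma] is the V_i coordinate. *)
Lemma N2_rho s i : N2 s i (i + 1) + N2 s (i + 1) i = 0.
Proof.
have /(congr1 (rho i)) : (D1 *m D0) s 0 = 0 by rewrite D1_D0 mxE.
by rewrite linear0 mxE rho_sum // big_split.
Qed.

Lemma N2_sigma s i :
  N2 s i (i + 2) + N2 s (i + 2) i + N2 s (i + 3) (i + 3) = 0.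
Proof.
have /(congr1 (sigma i)) : (D1 *m D0) s 0 = 0 by rewrite D1_D0 mxE.
by rewrite linear0 mxE sigma_sum // !big_split.
Qed.

(** Suffix [_r] marks relations in the last two letters, from D1 D0 = 0; suffix [_l] those in the
    first two, from D2 D1 = 0. *)
Lemma N3_rho_r q e i : N3 q e i (i + 1) + N3 q e (i + 1) i = 0.
Proof.
by rewrite -big_split big1 // => s _ /=; rewrite -mulrDr N2_rho mulr0.
Qed.

Lemma N3_sigma_r q e i :
  N3 q e i (i + 2) + N3 q e (i + 2) i + N3 q e (i + 3) (i + 3) = 0.
Proof.
by rewrite -!big_split big1 // => s _ /=; rewrite -!mulrDr N2_sigma mulr0.
Qed.

Lemma N3E q e i j :
  N3 q e i j = \sum_r (\sum_s g e (D2 q s) * g i (D1 s r)) * g j (D0 r 0).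
Proof.
under [RHS]eq_bigr => r _ do rewrite mulr_suml.
rewrite exchange_big; apply: eq_bigr => s _.
by rewrite mulr_sumr; apply: eq_bigr => r _; rewrite mulrA.
Qed.

Lemma N3_rho_l q i j : N3 q i (i + 1) j + N3 q (i + 1) i j = 0.
Proof.
rewrite !N3E -big_split big1 // => r _ /=; rewrite -mulrDl -big_split /=.
have /(congr1 (rho i)) : (D2 *m D1) q r = 0 by rewrite D2_D1 mxE.
by rewrite linear0 mxE rho_sum // => ->; rewrite mul0r.
Qed.

Lemma N3_sigma_l q i j :
  N3 q i (i + 2) j + N3 q (i + 2) i j + N3 q (i + 3) (i + 3) j = 0.
Proof.
rewrite !N3E -!big_split big1 // => r _ /=; rewrite -!mulrDl -!big_split /=.
have /(congr1 (sigma i)) : (D2 *m D1) q r = 0 by rewrite D2_D1 mxE.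
by rewrite linear0 mxE sigma_sum // => ->; rewrite mul0r.
Qed.

Lemma sum_rho (u : 'rV_m3) l i j :
  \sum_s rho l ((u *m D2) 0 s) * N2 s i j =
  \sum_q (g l (u 0 q) * N3 q (l + 1) i j + g (l + 1) (u 0 q) * N3 q l i j).
Proof.
rewrite /N3; under [RHS]eq_bigr => q _ do rewrite !mulr_sumr -big_split.
rewrite exchange_big; apply: eq_bigr => s _ /=.
rewrite mxE rho_sum // mulr_suml; apply: eq_bigr => q _; ring.
Qed.

Lemma sum_sigma (u : 'rV_m3) l i j :
  \sum_s sigma l ((u *m D2) 0 s) * N2 s i j =
  \sum_q (g l (u 0 q) * N3 q (l + 2) i j + g (l + 2) (u 0 q) * N3 q l i j
          + g (l + 3) (u 0 q) * N3 q (l + 3) i j).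
Proof.
rewrite /N3; under [RHS]eq_bigr => q _ do rewrite !mulr_sumr -!big_split.
rewrite exchange_big; apply: eq_bigr => s _ /=.
rewrite mxE sigma_sum // mulr_suml; apply: eq_bigr => q _; ring.
Qed.

Lemma obstruction_boundary (u : 'rV_m3) : obstruction (u *m D2) = 0.
Proof.
rewrite /obstruction !sum_rho sum_sigma -!big_split big1 // => q _ /=.
have e11 : 1 + 1 = 2 :> Z by ring.
have e21 : 2 + 1 = 3 :> Z by ring.
have e31 : 3 + 1 = 4 :> Z by ring.
have e12 : 1 + 2 = 3 :> Z by ring.
have e13 : 1 + 3 = 4 :> Z by ring.
have := N3_rho_l q 1 2; have := N3_sigma_l q 0 2; have := N3_rho_l q 2 3.
have := N3_rho_r q 3 2; have := N3_rho_l q 0 2; have := N3_sigma_l q 1 3.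
have := N3_rho_l q 3 4; have := N3_rho_r q 4 3; have := N3_rho_r q 3 1.
have := N3_rho_l q 2 1; have := N3_sigma_r q 2 1.
rewrite !add0r e11 e21 e31 e12 e13.
move=> r2s1 l21 r31 r43 l34 s13 l02 r32 l23 s02 l12.
(* Terms are grouped by the letter of u. In each group, terms are added and subtracted until every
   bracket is one relation: for the letter 1 these are [N3 q 3 2 3] and [N3 q 3 3 2]. *)
transitivity (
  g 0 (u 0 q) * (N3 q 1 2 2 + N3 q 2 1 2)
  + g 1 (u 0 q) * ((N3 q 0 2 2 + N3 q 2 0 2 + N3 q 3 3 2)
      + (N3 q 2 3 3 + N3 q 3 2 3) - (N3 q 3 2 3 + N3 q 3 3 2))
  + g 2 (u 0 q) * ((N3 q 0 1 2 + N3 q 1 0 2)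
      + (N3 q 1 3 3 + N3 q 3 1 3 + N3 q 4 4 3)
      + (N3 q 3 4 4 + N3 q 4 3 4) - (N3 q 4 3 4 + N3 q 4 4 3))
  + g 3 (u 0 q) * ((N3 q 3 1 2 + N3 q 3 2 1) - (N3 q 2 3 1 + N3 q 3 2 1)
      + (N3 q 2 1 3 + N3 q 2 3 1 + N3 q 2 4 4))).
  ring.
rewrite l12 s02 l23 r32 l02 s13 l34 r43 r31 l21 r2s1; ring.
Qed.

Lemma obstruction_cycle : exists v : 'rV_m2, v *m D1 = 0 /\ obstruction v = 1.
Proof.
have /boolp.choice[eps eps_D0] := D0_gen.
(* The commutation syzygy of X_(i+1) and X_(i+2), lifted through D1 to z_i. The cycle is the sum of
   the V_i z_i. *)
pose w i : 'rV_m1 := X (i + 1) *: eps (i + 2) - X (i + 2) *: eps (i + 1).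
have /boolp.choice[z wE] i : exists u, w i = u *m D1.
  apply: D1_exact; rewrite mulmxBl -!scalemxAl !eps_D0.
  by apply/matrixP => r s; rewrite !mxE mulrC subrr.
exists (\sum_i Vmon X i *: z i); split.
  rewrite mulmx_suml.
  transitivity
      (\sum_i Tmon X i *: eps (i + 2) - \sum_i Tmon X i *: eps (i + 2)).
    (* V_i times X_(i+1) and X_(i+2) gives T_i and T_(i-1), so a cyclic shift makes the sum
       telescope. *)
    rewrite [in X in _ - X](reindex_inj (addIr (- 1))) -sumrB.
    apply: eq_bigr => i _; rewrite -scalemxAl -wE scalerBr !scalerA.
    rewrite ![Vmon X i * _]mulrC !(mulXV (X_far frobX) (X_sq frobX)).
    ord_decide.
    by rewrite (_ : i - 1 + 2 = i + 1) //; ring.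
  exact: subrr.
have coefV t l : coef t (Vmon X l) = (t == IV l)%:R.
  exact: (coef_basis frobX t (IV l)).
(* Entries of the cycle are combinations of the V_l, so in degree 2 they have no U coordinates; only
   the sigma term of [obstruction] survives, and it sees the constant part of z_0. *)
have rho0 j s : rho j ((\sum_l Vmon X l *: z l) 0 s) = 0.
  rewrite summxE linear_sum big1 // => l _ /=; rewrite mxE (coef_UM frobX).
  by rewrite !coefV !mul0r !addr0.
have sigma0 s : sigma 0 ((\sum_l Vmon X l *: z l) 0 s) = kappa (z 0 0 s).
  rewrite summxE linear_sum (bigD1 0) //= big1 => [|l ne_l];
    rewrite mxE (coef_VM frobX).
    by rewrite !coefV eqxx !mul0r add0r !addr0 mul1r.
  rewrite !coefV !mul0r (_ : (IV 0 == IV l) = false) ?mul0r ?addr0 //.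
  by apply/negbTE; apply: contraNneq ne_l => -[->].
have rho_N2 l i j : \sum_s rho l ((\sum_l Vmon X l *: z l) 0 s) * N2 s i j = 0.
  by apply: big1 => s _; rewrite rho0 mul0r.
rewrite /obstruction !rho_N2 !add0r; under eq_bigr => s _ do rewrite sigma0.
have w0E r : g 1 (w 0 0 r) = kappa (eps 2 0 r).
  rewrite /w !mxE !add0r linearB /= !(coefX_mulX frobX) eqxx.
  by ord_decide; rewrite subr0.
(* As D1 is linear, the constants of z_0 alone determine the linear part of w_0 = z_0 D1. *)
transitivity (\sum_r g 1 (w 0 0 r) * g 2 (D0 r 0)).
  rewrite /N2; under eq_bigr => s _ do rewrite mulr_sumr.
  rewrite exchange_big; apply: eq_bigr => r _ /=.
  rewrite wE mxE linear_sum mulr_suml; apply: eq_bigr => s _ /=.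
  by rewrite (coef_linM frobX) (D1_lin s r (t := I0 n)) // mulr0 addr0 mulrA.
under eq_bigr => r _ do rewrite w0E.
(* As D0 is linear, only the constants of [eps 2] contribute, and [eps 2 *m D0] is X_2. *)
transitivity (g 2 ((eps 2 *m D0) 0 0)).
  rewrite mxE linear_sum; apply: eq_bigr => r _ /=.
  by rewrite (coef_linM frobX) (D0_lin r (t := I0 n)) // mulr0 addr0.
by rewrite eps_D0 mxE (coef_basis frobX (IX 2) (IX 2)) eqxx.
Qed.

Lemma not_exact : False.
Proof.
have [v [/D2_exact[u ->]]] := obstruction_cycle.
by rewrite obstruction_boundary => /eqP; rewrite eq_sym oner_eq0.
Qed.

End Resolution.

Lemma not_koszul_frobenius (gr : nat -> A -> Prop) :
  (forall d x, gr d x <-> forall t, bdeg t != d -> coef t x = 0) -> ~ koszul gr.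
Proof.
move=> grP [bt [d [bt0 d_lin d0_exact d_exact]]].
have d_comp m : d m.+1 *m d m = 0.
  apply/row_matrixP => r; rewrite row0 row_mul; apply/d_exact.
  by exists (delta_mx 0 r); rewrite -rowE.
have := d_comp 0%N; have := d_exact 0%N; have := d0_exact; have := d_lin 0%N.
(* Generalizing [d 0] allows its width to be rewritten to 1, so that it becomes a column. *)
move: (d 0%N); rewrite bt0 => D0 D0_lin D0_gen D1_exact D1_D0.
apply: (@not_exact _ _ _ D0 (d 1%N) (d 2%N)) => //.
- by move=> r; apply/grP/D0_lin.
- by move=> s r; apply/grP/d_lin.
- by move=> s r; apply/grP/d_lin.
- move=> i; have [|u uE] := (D0_gen (const_mx (X i))).2; last by exists u.
  move=> j; rewrite mxE; exists [:: (1, X i)]; split;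
    last by rewrite big_seq1 mul1r.
  move=> _ /[!inE] /eqP -> /=; exists 1%N => //; apply/grP => t.
  by rewrite (coef_basis frobX t (IX i)); case: (t =P IX i) => // ->.
- by move=> v /D1_exact.
- by move=> v /d_exact.
Qed.

End NotKoszul.

Theorem theorem4p1 (k : fieldType) (c : nat) (hc : (7 <= c)%N) :
  let I_F := annihilator (cyclicF_neq0 k hc) in
  let R := {ideal_quot I_F} in
  [/\ quadratic_ideal (fun f => f \in I_F),
      gorenstein R,
      ~ koszul (@quot_gr k c I_F)
    & h_vector (@quot_gr k c I_F) [:: 1; c%:Z; (2 * c)%:Z; c%:Z; 1]].
Proof.
(* Replacing c by c + 7 exposes the successors that give the index type its ring structure modulo
   c. *)
do 7![case: c hc => [//|c] hc] => I_F R.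
have I_far (i j : 'I_c.+4.+3) : far i j -> 'X_i * 'X_j \in I_F.
  by move=> far_ij; apply/quadric_annihilator; constructor.
have I_sq (i : 'I_c.+4.+3) :
    'X_(i + 3) * 'X_(i + 3) - 'X_i * 'X_(i + 2) \in I_F.
  by apply/quadric_annihilator; constructor.
have soc_I f : f \in I_F -> soc f = 0 by apply: soc_annihilator.
have frobR := quotient_frobenius I_far I_sq soc_I.
have grP := quot_grP I_far I_sq soc_I.
split.
- exact: annihilator_quadratic.
- exact: gorenstein_frobenius frobR.
- exact: not_koszul_frobenius frobR _ grP.
- exact: h_vector_gr frobR grP.
Qed.
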